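(* Let $k=\mathbb C$ and $S=\mathbb C[[\alpha_1,\dots,\alpha_n]]$. For every $f\in P$ the orbit $\mathbb G^+\cdot f$ is closed in $P$, in both the Euclidean and the Zariski topologies.
   Context: Let $\mathfrak m$ be the maximal ideal of $S$. $P$ is the space of $\mathbb C$-linear functionals on $S$ vanishing on some power of $\mathfrak m$; pairing $\langle-,-\rangle:S\times P\to\mathbb C$. It has a basis $\mathbf x^{[\mathbf a]}$ ($\mathbf a\in\mathbb N_0^n$, of degree $\sum a_i$) dual to the monomials $\alpha^{\mathbf a}$; $P_{\le D}$ is the finite-dimensional span of those of degree at most $D$. $\operatorname{Aut}^+(S)$ is the group of $\mathbb C$-algebra automorphisms $\varphi$ of $S$ with $\varphi(\alpha_i)-\alpha_i\in\mathfrak m^2$ for all $i$, and $\mathbb G^+=\operatorname{Aut}^+(S)\ltimes(1+\mathfrak m)$ is the group of linear operators on $S$ generated by $\operatorname{Aut}^+(S)$ and by multiplications by elements of $1+\mathfrak m$. Each $\varphi\in\mathbb G^+$ acts on $P$ by its dual map $\varphi^\vee$, $\langle\sigma,\varphi^\vee(f)\rangle=\langle\varphi(\sigma),f\rangle$, and $\mathbb G^+\cdot f=\{\varphi^\vee(f):\varphi\in\mathbb G^+\}$. The orbit of $f$ is contained in $P_{\le D}$ for $D\geq \deg f$, and closedness is understood in the affine space $P_{\le D}$ for all $D\gg0$ (one may replace $S$ by $S/\mathfrak m^{D+1}$ with $D\gg 0$). *)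

(* Defs.v *)
From HB Require Import structures.
From mathcomp Require Import all_boot all_order all_algebra.
From mathcomp Require Import complex.
From mathcomp Require Import boolp classical_sets functions reals.
From mathcomp Require Import topology normedtype sequences.
(* The notations of mpoly clash with those of MathComp-Analysis.  Beware that
   [multinom n] is the type of exponents of monomials in n variables. *)
From mathcomp Require Import -(notations) mpoly.

Set Implicit Arguments.
Unset Strict Implicit.
Unset Printing Implicit Defensive.

Import Order.TTheory GRing.Theory Num.Theory.
Import numFieldNormedType.Exports.

Local Open Scope classical_set_scope.
Local Open Scope ring_scope.

Record mpseries (K : Type) (n : nat) :=
  MPSeries { coefs : multinom n -> K }.

Lemma mpseriesP (K : Type) n (s t : mpseries K n) :
  (forall a, coefs s a = coefs t a) -> s = t.
Proof. by case: s t => [s] [t] /= /funext ->. Qed.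

HB.instance Definition _ (K : Type) n := gen_eqMixin (mpseries K n).
HB.instance Definition _ (K : Type) n := gen_choiceMixin (mpseries K n).

Section Algebra.
Variables (K : comNzRingType) (n : nat).
Local Notation S := (mpseries K n).
Implicit Types (s t u : S) (a : multinom n).

Definition mps0 : S := MPSeries (fun=> 0).
Definition mpsN s : S := MPSeries (fun a => - coefs s a).
Definition mpsD s t : S := MPSeries (fun a => coefs s a + coefs t a).
Definition mpsZ (c : K) s : S := MPSeries (fun a => c * coefs s a).
Definition mps1 : S := MPSeries (fun a => (a == mnm0)%:R).

(* Cauchy product; the pair k ranges over exponents of degree <= mdeg a. *)
Definition mpsM s t : S := MPSeries (fun a =>
  \sum_(k : bmultinom n (mdeg a).+1 * bmultinom n (mdeg a).+1
         | a == mnm_add k.1 k.2) coefs s k.1 * coefs t k.2).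

Fact mpsDA : associative mpsD.
Proof. by move=> s t u; apply: mpseriesP => a /=; rewrite addrA. Qed.
Fact mpsDC : commutative mpsD.
Proof. by move=> s t; apply: mpseriesP => a /=; rewrite addrC. Qed.
Fact mps0D : left_id mps0 mpsD.
Proof. by move=> s; apply: mpseriesP => a /=; rewrite add0r. Qed.
Fact mpsND : left_inverse mps0 mpsN mpsD.
Proof. by move=> s; apply: mpseriesP => a /=; rewrite addNr. Qed.

HB.instance Definition _ :=
  GRing.isZmodule.Build S mpsDA mpsDC mps0D mpsND.

Definition mps_trunc d s : mpoly n K :=
  \sum_(k : bmultinom n d) coefs s k *: mpolyX K k.

Lemma mcoeff_trunc d s a :
  (mdeg a < d)%N -> mcoeff a (mps_trunc d s) = coefs s a.
Proof.
move=> lt_a_d; rewrite raddf_sum (bigD1 (BMultinom lt_a_d)) //=.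
rewrite mcoeffZ mcoeffX eqxx mulr1 big1 ?addr0 // => k /negPf k_neq.
rewrite mcoeffZ mcoeffX; case: eqP => [eq_ka | _]; last by rewrite mulr0.
by move: k_neq; rewrite bmeqP /= eq_ka eqxx.
Qed.

Lemma mpsM_mcoeff s t (p q : mpoly n K) a :
  (forall b, mdeg b <= mdeg a -> mcoeff b p = coefs s b)%N ->
  (forall b, mdeg b <= mdeg a -> mcoeff b q = coefs t b)%N ->
  coefs (mpsM s t) a = mcoeff a (p * q).
Proof.
move=> ps qt; rewrite mcoeffM /=; apply: eq_bigr => k _.
by rewrite ps ?qt // -ltnS bmdeg.
Qed.

Fact mpsMA : associative mpsM.
Proof.
move=> s t u; apply: mpseriesP => a.
pose T := mps_trunc (mdeg a).+1.
have TE v b : (mdeg b <= mdeg a)%N -> mcoeff b (T v) = coefs v b.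
  by move=> le_ba; rewrite mcoeff_trunc // ltnS.
have MTE v w b : (mdeg b <= mdeg a)%N ->
    mcoeff b (T v * T w) = coefs (mpsM v w) b.
  move=> le_ba; rewrite (@mpsM_mcoeff v w (T v) (T w)) // => c le_cb;
  by apply: TE (leq_trans le_cb le_ba).
rewrite (@mpsM_mcoeff _ _ (T s) (T t * T u)); [|exact: TE|exact: MTE].
by rewrite (@mpsM_mcoeff _ _ (T s * T t) (T u)) ?mulrA //; [exact: MTE|exact: TE].
Qed.

Fact mpsMC : commutative mpsM.
Proof.
move=> s t; apply: mpseriesP => a; pose T := mps_trunc (mdeg a).+1.
have TE v b : (mdeg b <= mdeg a)%N -> mcoeff b (T v) = coefs v b.
  by move=> le_ba; rewrite mcoeff_trunc // ltnS.
rewrite (@mpsM_mcoeff _ _ (T s) (T t)); [|exact: TE|exact: TE].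
by rewrite (@mpsM_mcoeff _ _ (T t) (T s)) 1?mulrC //; exact: TE.
Qed.

Fact mps1M : left_id mps1 mpsM.
Proof.
move=> s; apply: mpseriesP => a; pose T := mps_trunc (mdeg a).+1.
rewrite (@mpsM_mcoeff _ _ 1 (T s)) ?mul1r ?mcoeff_trunc //.
  by move=> b _; rewrite mcoeff1.
by move=> b le_ba; rewrite mcoeff_trunc // ltnS.
Qed.

Fact mpsMDl : left_distributive mpsM mpsD.
Proof.
move=> s t u; apply: mpseriesP => a /=; rewrite -big_split /=.
by apply: eq_bigr => k _; rewrite mulrDl.
Qed.

Fact mps1_neq0 : mps1 != 0 :> S.
Proof.
apply/eqP => /(congr1 (fun s => coefs s mnm0)) /=.
by rewrite eqxx => /eqP; rewrite oner_eq0.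
Qed.

HB.instance Definition _ :=
  GRing.Zmodule_isComNzRing.Build S mpsMA mpsMC mps1M mpsMDl mps1_neq0.

Fact mpsZA c d s : mpsZ c (mpsZ d s) = mpsZ (c * d) s.
Proof. by apply: mpseriesP => a /=; rewrite mulrA. Qed.
Fact mps1Z : left_id 1 mpsZ.
Proof. by move=> s; apply: mpseriesP => a /=; rewrite mul1r. Qed.
Fact mpsZDr : right_distributive mpsZ +%R.
Proof. by move=> c s t; apply: mpseriesP => a /=; rewrite mulrDr. Qed.
Fact mpsZDl s : {morph mpsZ^~ s : c d / c + d}.
Proof. by move=> c d; apply: mpseriesP => a /=; rewrite mulrDl. Qed.

HB.instance Definition _ :=
  GRing.Zmodule_isLmodule.Build K S mpsZA mps1Z mpsZDr mpsZDl.

Fact mpsZAl (c : K) s t : c *: (s * t) = c *: s * t.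
Proof.
apply: mpseriesP => a /=; rewrite mulr_sumr.
by apply: eq_bigr => k _; rewrite mulrA.
Qed.

HB.instance Definition _ := GRing.Lmodule_isLalgebra.Build K S mpsZAl.
HB.instance Definition _ := GRing.Lalgebra_isComAlgebra.Build K S.

Definition mpsX (i : 'I_n) : S := MPSeries (fun a => (a == mnm1 i)%:R).

End Algebra.

(* k-th power of an ideal I: the ideal generated by the k-fold products of
   elements of I (the coefficients c matter only when k = 0). *)
Definition ideal_exp (A : comNzRingType) (I : set A) (k : nat) : set A :=
  [set s | exists (r : nat) (c : 'I_r -> A) (x : 'I_r -> 'I_k -> A),
     (forall i j, I (x i j)) /\ s = \sum_(i < r) c i * \prod_(j < k) x i j].

Section Orbits.
Variables (K : numFieldType) (n : nat).
Local Notation S := (mpseries K n).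

Definition maxideal : set S := [set s | coefs s mnm0 = 0].

(* The pairing <s, f> is the value f s. *)
Definition Pspace : set (S -> K) :=
  [set f | scalar f /\
     exists k, forall s, ideal_exp maxideal k s -> f s = 0].

Definition dual_monomial (a : multinom n) : S -> K := fun s => coefs s a.

Definition dimP (D : nat) : nat := #|{: bmultinom n D.+1}|.

(* The linear isomorphism from K^N, N = dimP D, onto P_{<=D} given by the basis
   of the dual monomials of degree at most D. *)
Definition of_coords (D : nat) (v : 'rV[K]_(dimP D)) : S -> K :=
  fun s => \sum_(i < dimP D) v 0 i * dual_monomial (bmnm (enum_val i)) s.

Definition Ple (D : nat) : set (S -> K) := range (@of_coords D).

Definition is_Autp (phi : {lrmorphism S -> S}) : Prop :=
  bijective phi /\
  forall i, ideal_exp maxideal 2 (phi (mpsX K i) - mpsX K i).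

Inductive Gp : (S -> S) -> Prop :=
| Gp_aut (phi : {lrmorphism S -> S}) : is_Autp phi -> Gp phi
| Gp_mul (u : S) : maxideal (u - 1) -> Gp (fun s => u * s)
| Gp_comp (phi psi : S -> S) : Gp phi -> Gp psi -> Gp (phi \o psi)
| Gp_inv (phi psi : S -> S) :
    Gp phi -> cancel phi psi -> cancel psi phi -> Gp psi.

Definition dual_map (phi : S -> S) (f : S -> K) : S -> K :=
  fun s => f (phi s).

Definition Gp_orbit (f : S -> K) : set (S -> K) :=
  [set dual_map phi f | phi in Gp].

Definition zariski_closed (N : nat) (A : set 'rV[K]_N) : Prop :=
  exists I : set (mpoly N K),
    A = [set v | forall p, I p -> meval (v ord0) p = 0].

Definition euclidean_closed (N : nat) (A : set 'rV[K]_N) : Prop := closed A.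

(* A is contained, and closed, in the affine space P_{<=D} for all D >> 0. *)
Definition closed_in_P (is_closed : forall N, set 'rV[K]_N -> Prop)
    (A : set (S -> K)) : Prop :=
  \forall D \near \oo,
    A `<=` Ple D /\ is_closed (dimP D) (@of_coords D @^-1` A).

End Orbits.

(* Main.v *)
(* Every operator T in G^+ is unipotent: T - 1 raises the order of series.  Hence
   T^t = sum_k binom(t, k) (T - 1)^k makes sense for every scalar t, and an
   identity between such powers holds for all t as soon as it holds for natural
   t, both sides being polynomial in t coefficientwise.  In this way T^t is again
   in G^+: if T = u psi then T^t = T^t(1) psi^t, and psi^t is an automorphism.
   On P_{<=D} the group G^+ thus acts by unitriangular matrices, through a group
   closed under g |-> g^t.  For such a group every orbit is Zariski closed: this
   replaces the general theorem of Kostant and Rosenlicht by an induction on the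
   coordinates in which one-parameter families g^t straighten the orbit. *)
Require Import Defs.
From HB Require Import structures.
From mathcomp Require Import all_boot all_order all_algebra.
From mathcomp Require Import complex.
From mathcomp Require Import boolp classical_sets functions reals.
From mathcomp Require Import topology normedtype.
From mathcomp Require Import ring.
From mathcomp Require Import -(notations) mpoly.

Set Implicit Arguments.
Unset Strict Implicit.
Unset Printing Implicit Defensive.

Import Order.TTheory GRing.Theory Num.Theory.
Import numFieldNormedType.Exports.

Local Open Scope classical_set_scope.
Local Open Scope ring_scope.

(** * Polynomial functions on affine space and Zariski closed sets *)

Section PolynomialFunctions.
Variables (K : numFieldType) (N : nat).
Implicit Types (F G : 'rV[K]_N -> K).

Definition polynomial_fun F :=
  exists p : mpoly N K, forall w, F w = meval (w ord0) p.

Lemma polynomial_fun_cst c : polynomial_fun (fun=> c).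
Proof. by exists (mpolyC N c) => w; rewrite mevalC. Qed.

Lemma polynomial_fun_coord i : polynomial_fun (fun w => w 0 i).
Proof. by exists (mpolyX K (mnm1 i)) => w; rewrite mevalXU. Qed.

Lemma polynomial_funD F G :
  polynomial_fun F -> polynomial_fun G -> polynomial_fun (fun w => F w + G w).
Proof.
by move=> [p Fp] [q Gq]; exists (p + q) => w; rewrite mevalD Fp Gq.
Qed.

Lemma polynomial_funM F G :
  polynomial_fun F -> polynomial_fun G -> polynomial_fun (fun w => F w * G w).
Proof.
by move=> [p Fp] [q Gq]; exists (p * q) => w; rewrite mevalM Fp Gq.
Qed.

Lemma polynomial_fun_sum (I : finType) (F : I -> 'rV[K]_N -> K) :
  (forall i, polynomial_fun (F i)) -> polynomial_fun (fun w => \sum_i F i w).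
Proof.
move=> Fpoly; rewrite -fct_sumE.
by elim/big_ind: _ => [|G H|i _] //; [exact: polynomial_fun_cst|
  exact: polynomial_funD].
Qed.

Lemma polynomial_fun_prod (I : finType) (F : I -> 'rV[K]_N -> K) :
  (forall i, polynomial_fun (F i)) -> polynomial_fun (fun w => \prod_i F i w).
Proof.
move=> Fpoly; rewrite (_ : (fun w => _) = \prod_i F i); last first.
  by apply/funext => w; rewrite fct_prodE.
by elim/big_ind: _ => [|G H|i _] //; [exact: polynomial_fun_cst|
  exact: polynomial_funM].
Qed.

(** Substituting the coordinate polynomials of [F] into equations for [A] gives equations for the
    preimage. *)
Lemma zariski_closed_preimage (F : 'rV[K]_N -> 'rV[K]_N) (A : set 'rV[K]_N) :
  (forall i, polynomial_fun (fun w => F w 0 i)) ->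
  zariski_closed A -> zariski_closed (F @^-1` A).
Proof.
move=> /choice[p Fp] [I ->]; pose lp := [tuple p i | i < N].
have lpE w q : meval (F w ord0) q = meval (w ord0) (comp_mpoly lp q).
  rewrite comp_mpoly_meval; apply: meval_eq => i.
  by rewrite tnth_mktuple Fp.
exists (comp_mpoly lp @` I); apply/seteqP; split=> w /=.
  by move=> Iw _ [q Iq <-]; rewrite -lpE Iw.
by move=> Iw q Iq; rewrite lpE; apply: Iw; exists q.
Qed.

Lemma zariski_closed1 (v : 'rV[K]_N) : zariski_closed [set v].
Proof.
exists [set mpolyX K (mnm1 i) - mpolyC N (v 0 i) | i in setT].
apply/seteqP; split=> w /= => [-> _ [i _ <-]|vw].
  by rewrite mevalB mevalXU mevalC subrr.
apply/rowP => i; apply/eqP; rewrite -subr_eq0; apply/eqP.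
have := vw _ (ex_intro2 _ _ i I erefl).
by rewrite mevalB mevalXU mevalC.
Qed.

(** Polynomial evaluations are continuous, and [A] is an intersection of preimages of the closed
    point 0 under them. *)
Lemma zariski_closed_euclidean (A : set 'rV[K]_N) :
  zariski_closed A -> euclidean_closed A.
Proof.
move=> [I ->]; rewrite /euclidean_closed.
rewrite [X in closed X](_ : _ = \bigcap_(p in I)
    ((fun v : 'rV[K]_N => meval (v ord0) p) @^-1` [set 0])); last by [].
apply: closed_bigI => p _; apply: preimage_closed => [v _|]; last first.
  exact/accessible_closed_set1/hausdorff_accessible/norm_hausdorff.
elim/mpolyind: p => [|c m p _ _ IHp].
  rewrite (_ : (fun v => _) = cst 0); first exact: cst_continuous.
  by apply/funext => w; rewrite meval0.
rewrite (_ : (fun v => _) = (cst c \* (fun w : 'rV[K]_N =>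
    \prod_(i < N) w 0 i ^+ m i)) + (fun w => meval (w ord0) p)); last first.
  by apply/funext => w; rewrite mevalD mevalZ mevalX.
apply: continuousD => //; apply: continuousM; first exact: cst_continuous.
rewrite (_ : (fun w => _) =
    \prod_(i < N) (fun w : 'rV[K]_N => w 0 i ^+ m i)); last first.
  by apply/funext => w; rewrite fct_prodE.
elim/big_ind: _ => [|F G Fc Gc|i _]; first exact: cst_continuous.
  exact: continuousM.
elim: (m i) => [|k IHk]; first exact: cst_continuous.
rewrite (_ : (fun w => _) = (fun w : 'rV[K]_N => w 0 i) \*
    (fun w => w 0 i ^+ k)); last by apply/funext => w; rewrite exprS.
by apply: continuousM => //; exact: coord_continuous.
Qed.

End PolynomialFunctions.

(** * Binomial coefficients with scalar argument, and interpolation *)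

Section GeneralizedBinomials.
Variable K : numFieldType.

Definition gbin (k : nat) (t : K) : K :=
  (\prod_(i < k) (t - i%:R)) / k`!%:R.

Lemma gbin0 t : gbin 0 t = 1.
Proof. by rewrite /gbin big_ord0 fact0 divr1. Qed.

Lemma gbin1 t : gbin 1 t = t.
Proof. by rewrite /gbin big_ord1 subr0 factS fact0 muln1 divr1. Qed.

Lemma gbinS_0 k : gbin k.+1 0 = 0.
Proof. by rewrite /gbin big_ord_recl subrr !mul0r. Qed.

(** All terms share the factor $t(t-1)\cdots(t-k+1)$; what remains is $t+1=(t-k)+(k+1)$. *)
Lemma gbin_pascal k t : gbin k.+1 (t + 1) = gbin k.+1 t + gbin k t.
Proof.
rewrite /gbin big_ord_recl [X in _ = X / _ + _]big_ord_recr /= subr0 factS natrM.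
have -> : \prod_(i < k) (t + 1 - (lift ord0 i)%:R) = \prod_(i < k) (t - i%:R).
  by apply: eq_bigr => i _; rewrite lift0 -[i.+1]addn1 natrD; ring.
have k1 : (k.+1%:R : K) != 0 by rewrite pnatr_eq0.
have kf : (k`!%:R : K) != 0 by rewrite pnatr_eq0 -lt0n fact_gt0.
by rewrite -natr1 in k1 *; field; rewrite kf k1.
Qed.

Definition poly_fun (F : K -> K) := exists p : {poly K}, forall t, F t = p.[t].

Lemma poly_fun_cst c : poly_fun (fun=> c).
Proof. by exists c%:P => t; rewrite hornerC. Qed.

Lemma poly_funD F G :
  poly_fun F -> poly_fun G -> poly_fun (fun t => F t + G t).
Proof. by move=> [p Fp] [q Gq]; exists (p + q) => t; rewrite hornerD Fp Gq. Qed.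

Lemma poly_funM F G :
  poly_fun F -> poly_fun G -> poly_fun (fun t => F t * G t).
Proof. by move=> [p Fp] [q Gq]; exists (p * q) => t; rewrite hornerM Fp Gq. Qed.

Lemma poly_fun_sum (I : finType) (P : pred I) (F : I -> K -> K) :
  (forall i, P i -> poly_fun (F i)) -> poly_fun (fun t => \sum_(i | P i) F i t).
Proof.
move=> Fpoly; rewrite -fct_sumE.
by elim/big_ind: _ => [|G H|i /Fpoly] //; [exact: poly_fun_cst|
  exact: poly_funD].
Qed.

Lemma poly_fun_gbin k c : poly_fun (fun t => gbin k (c + t)).
Proof.
exists ((k`!%:R)^-1 *: \prod_(i < k) (c%:P + 'X - i%:R%:P)) => t.
rewrite hornerZ horner_prod mulrC; congr (_ * _).
by apply: eq_bigr => i _; rewrite !hornerE.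
Qed.

(** A nonzero polynomial has fewer roots than its size, and the natural numbers are pairwise
    distinct in [K]. *)
Lemma poly_fun_ext F G : poly_fun F -> poly_fun G ->
  (forall m : nat, F m%:R = G m%:R) -> F =1 G.
Proof.
move=> [p Fp] [q Gq] FG t; rewrite Fp Gq.
suff -> : p = q by [].
apply/eqP; rewrite -subr_eq0; apply/eqP.
apply: (@roots_geq_poly_eq0 _ _ [seq m%:R | m <- iota 0 (size (p - q))]).
- apply/allP => _ /mapP[m _ ->]; rewrite rootE hornerD hornerN -Fp -Gq FG.
  by rewrite subrr.
- rewrite map_inj_uniq ?iota_uniq // => m m' /eqP.
  by rewrite eqr_nat => /eqP.
- by rewrite size_map size_iota.
Qed.

End GeneralizedBinomials.

(** * Orbits of unitriangular matrix groups closed under scalar powers *)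

Section UnitriangularOrbits.
Variables (K : numFieldType) (N : nat) (deg : 'I_N -> nat) (m : nat).
Implicit Types (g h : 'M[K]_N) (G : set 'M[K]_N) (u v w : 'rV[K]_N).
Implicit Types (A : {set 'I_N}) (i j : 'I_N).

(** The binomial series of $g^t$, cut after exponent $m+1$; there are always at least two terms, so
    that $1+t(g-1)$ can be split off. *)
Definition mxpow g (t : K) : 'M[K]_N := \sum_(k < m.+2) gbin k t *: (g - 1) ^+ k.

(** Matrices act on rows from the right: coordinate [j] of $wg-w$ involves only coordinates of $w$
    of degree larger than [deg j]. *)
Definition unitriangular g :=
  forall i j, (deg i <= deg j)%N -> (g - 1) i j = 0.

(** The field [ugroup_pow] stands in for algebraicity: each element lies on a polynomial
    one-parameter family inside [G]. *)
Record unipotent_group G : Prop := {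
  ugroup_unitriangular : forall g, G g -> unitriangular g;
  ugroup1 : G 1;
  ugroupM : forall g h, G g -> G h -> G (g *m h);
  ugroupV : forall g, G g -> exists2 h, G h & g *m h = 1;
  ugroup_pow : forall g t, G g -> G (mxpow g t) }.

Let upclosed A := forall i j, j \in A -> (deg j < deg i)%N -> i \in A.

Lemma unitriangular_mulr g A j w : unitriangular g ->
  (forall i, (deg j < deg i)%N -> i \in A) ->
  (forall i, i \in A -> w 0 i = 0) -> (w *m (g - 1)) 0 j = 0.
Proof.
move=> tri_g jA w0; rewrite mxE big1 // => i _.
by case: (ltnP (deg j) (deg i)) => [/jA/w0 -> | /tri_g ->];
  rewrite ?mul0r ?mulr0.
Qed.

Lemma unitriangular_agree g A j u w : unitriangular g ->
  (forall i, (deg j < deg i)%N -> i \in A) ->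
  (forall i, i \in A -> u 0 i = w 0 i) ->
  (u *m g) 0 j - u 0 j = (w *m g) 0 j - w 0 j.
Proof.
move=> tri_g jA uw.
have : ((u - w) *m (g - 1)) 0 j = 0.
  apply: (unitriangular_mulr tri_g jA) => i iA.
  by rewrite !mxE uw ?subrr.
rewrite mulmxBr mulmx1 mulmxBl !mxE => /eqP.
by rewrite opprB addrCA addrA subr_eq0 => /eqP <-; ring.
Qed.

(** The vector $v(g-1)$ vanishes on [A] and equals $c$ at [j]; hence $v(g-1)^k$ with $k\ge2$
    vanishes at [j] too, and only the linear term of the series survives. *)
Lemma mulmx_pow g A v c j t : unitriangular g -> upclosed A ->
  (forall i, (deg j < deg i)%N -> i \in A) ->
  (forall i, i \in A -> (v *m g) 0 i = v 0 i) ->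
  (v *m g) 0 j = v 0 j + c ->
  (forall i, i \in A -> (v *m mxpow g t) 0 i = v 0 i) /\
  (v *m mxpow g t) 0 j = v 0 j + t * c.
Proof.
move=> tri_g upA jA fixA vj.
pose x k := v *m (g - 1) ^+ k.+1.
have xS k : x k.+1 = x k *m (g - 1) by rewrite /x exprSr mulmxA.
have x0 i : x 0%N 0 i = (v *m g) 0 i - v 0 i.
  by rewrite /x expr1 mulmxBr mulmx1 !mxE.
have xA k i : i \in A -> x k 0 i = 0.
  elim: k i => [|k IHk] i iA; first by rewrite x0 fixA ?subrr.
  by rewrite xS; apply: (unitriangular_mulr tri_g) IHk => l; apply: upA.
have xj k : x k.+1 0 j = 0.
  by rewrite xS; apply: (unitriangular_mulr tri_g) jA (xA k).
have powE i : (v *m mxpow g t) 0 i =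
    v 0 i + (t * x 0%N 0 i + \sum_(k < m) gbin k.+2 t * x k.+1 0 i).
  rewrite mulmx_sumr summxE !big_ord_recl /= gbin0 gbin1 scale1r expr0 mulmx1.
  rewrite -scalemxAr mxE; congr (_ + (_ + _)).
  by apply: eq_bigr => k _; rewrite -scalemxAr mxE.
split=> [i iA|]; rewrite powE.
  by rewrite xA // mulr0 add0r big1 ?addr0 // => k _; rewrite xA ?mulr0.
by rewrite x0 vj big1 => [|k _]; [ring|rewrite xj mulr0].
Qed.

(** The coordinates in an upward closed [A] transform among themselves, so this is a genuine
    stabilizer; [mulmx_pow] shows that it contains the scalar powers of its elements. *)
Lemma stabilizer_unipotent_group G A v : upclosed A -> unipotent_group G ->
  unipotent_group
    [set g | G g /\ forall i, i \in A -> (v *m g) 0 i = v 0 i].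
Proof.
move=> upA [Gtri G1 GM GV Gpow].
have agree g u w : G g -> (forall i, i \in A -> u 0 i = w 0 i) ->
    forall i, i \in A -> (u *m g) 0 i = (w *m g) 0 i.
  move=> /Gtri tri_g uw i iA.
  have := @unitriangular_agree g A i u w tri_g (fun l => upA l i iA) uw.
  by rewrite uw // => /addIr.
split=> [g [/Gtri]|||g [Gg fix_g]|g t [Gg fix_g]] //=.
- by split=> // i _; rewrite mulmx1.
- move=> g h [Gg fix_g] [Gh fix_h]; split; first exact: GM.
  by move=> i iA; rewrite mulmxA (agree _ _ v) ?fix_h.
- have [h Gh gh] := GV g Gg; exists h => //; split=> // i iA.
  have vgh : v = v *m g *m h by rewrite -mulmxA gh mulmx1.
  by rewrite [RHS](congr1 (fun w => w 0 i) vgh); apply/esym/agree.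
- split=> [|i iA]; first exact: Gpow.
  have jA l : (deg i < deg l)%N -> l \in A by exact: upA.
  by have [->] := mulmx_pow t (Gtri g Gg) upA jA fix_g
    (esym (subrKC (v 0 i) ((v *m g) 0 i))).
Qed.

(* Induction on the number of coordinates that are not yet known to be fixed:
   if [v *m g] differs from [v] by [c] in the next coordinate [j], then the
   powers of [g] slide any point of the orbit back to the coordinate [v 0 j], so
   that the orbit is the preimage, by a polynomial map, of the orbit of the
   stabilizer of [v 0 j]. *)
Theorem unipotent_orbit_closed G v :
  unipotent_group G -> zariski_closed [set v *m g | g in G].
Proof.
suff main d A H : #|~: A| = d -> upclosed A -> unipotent_group H ->
    (forall g, H g -> forall i, i \in A -> (v *m g) 0 i = v 0 i) ->
    zariski_closed [set v *m g | g in H].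
  by move=> uG; apply: (main _ finset.set0 G erefl) => // [i j|g _ i];
    rewrite inE.
elim: d A H => [|d IHd] A H cardA upA uH fixA.
  have -> : [set v *m g | g in H] = [set v].
    apply/seteqP; split=> w /= => [[g Hg <-]|->].
      apply/rowP => i; apply: fixA => //; apply: contraT => iA.
      by move/eqP: cardA; rewrite cards_eq0 => /eqP/setP/(_ i); rewrite !inE iA.
    by exists 1; [exact: ugroup1 uH|rewrite mulmx1].
  exact: zariski_closed1.
have [j0 j0A] : exists j0, j0 \in ~: A by apply/card_gt0P; rewrite cardA.
rewrite inE in j0A.
(* Maximal degree outside [A] puts every coordinate of larger degree in [A], so that [j |: A] is
   again upward closed. *)
have [j [jA jmax]] :
    exists j, j \notin A /\ forall i, (deg j < deg i)%N -> i \in A.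
  case: (@arg_maxnP _ j0 (fun j => j \notin A) deg j0A) => j jA jmax.
  exists j; split=> // i; apply: contraTT => iA.
  by rewrite -leqNgt; apply: jmax.
pose A' := j |: A.
have upA' : upclosed A'.
  move=> i l; rewrite !inE => /orP[/eqP -> /jmax -> | lA /(upA _ _ lA) ->];
  by rewrite orbT.
have cardA' : #|~: A'| = d.
  move: cardA; rewrite (cardsD1 j (~: A)) finset.in_setC jA => -[<-]; apply: eq_card => i.
  by rewrite !inE negb_or.
pose H' := [set g | H g /\ forall i, i \in A' -> (v *m g) 0 i = v 0 i].
have H'closed : zariski_closed [set v *m g | g in H'].
  apply: (IHd A') => //; first exact: stabilizer_unipotent_group.
  by move=> g [].
have [fixj|] := pselect (forall g, H g -> (v *m g) 0 j = v 0 j).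
  suff -> : H = H' by [].
  apply/seteqP; split=> g => [Hg|[]] //; split=> // i.
  by rewrite !inE => /orP[/eqP -> | /fixA]; [exact: fixj|exact].
move=> /existsNP[g /not_implyP[Hg /eqP]]; rewrite -subr_eq0.
set c := _ - _ => c0.
have vgj : (v *m g) 0 j = v 0 j + c by rewrite subrKC.
have vpow t := mulmx_pow t (ugroup_unitriangular uH Hg) upA jmax (fixA g Hg) vgj.
(* The exponent $t$ solves $tc=v_j-w_j$, so $g^t$ brings coordinate [j] of an orbit point $w$ back
   to $v_j$. It is affine in $w$, hence [F] is polynomial. *)
pose F w := w *m mxpow g (- ((w 0 j - v 0 j) / c)).
have -> : [set v *m g | g in H] = F @^-1` [set v *m g | g in H'].
  apply/seteqP; split=> w /=.
    move=> [h Hh <-].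
    rewrite /F; set t := - _; have tc : t * c = v 0 j - (v *m h) 0 j.
      by rewrite /t mulNr divfK // opprB.
    have Ht : H (mxpow g t) by exact: ugroup_pow.
    exists (h *m mxpow g t); last by rewrite mulmxA.
    split=> [|i]; first exact: ugroupM.
    rewrite !inE => /orP[/eqP ->|iA]; last by apply: fixA => //; exact: ugroupM.
    (* Since $vh$ and $v$ agree on [A], $g^t$ shifts coordinate [j] of both by the same amount
       $tc$. *)
    rewrite mulmxA; apply: (addIr (- (v *m h) 0 j)).
    rewrite (unitriangular_agree (ugroup_unitriangular uH Ht) jmax (fixA h Hh)).
    by rewrite (proj2 (vpow t)) tc; ring.
  rewrite /F; set t := - _ => -[h [Hh _] vh].
  have [g' Hg' gg'] := ugroupV uH (ugroup_pow uH t Hg).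
  exists (h *m g'); first exact: ugroupM.
  by rewrite mulmxA vh -mulmxA gg' mulmx1.
apply: zariski_closed_preimage => // i.
under eq_fun do rewrite /F mxE.
apply: polynomial_fun_sum => l; apply: polynomial_funM.
  exact: polynomial_fun_coord.
under eq_fun do rewrite summxE.
apply: polynomial_fun_sum => k; under eq_fun do rewrite mxE.
apply: polynomial_funM; last exact: polynomial_fun_cst.
apply: polynomial_funM; last exact: polynomial_fun_cst.
apply: polynomial_fun_prod => q; apply: polynomial_funD; last first.
  exact: polynomial_fun_cst.
under eq_fun do rewrite -mulrN1.
apply: polynomial_funM; last exact: polynomial_fun_cst.
apply: polynomial_funM; last exact: polynomial_fun_cst.
apply: polynomial_funD; last exact: polynomial_fun_cst.
exact: polynomial_fun_coord.
Qed.

End UnitriangularOrbits.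

(** * The order of a power series and the powers of $\mathfrak m$ *)

Section Order.
Variables (K : numFieldType) (n : nat).
Local Notation S := (mpseries K n).
Implicit Types (s t : S) (a b : multinom n) (k : nat).

Lemma dual_monomial_is_scalar a : scalar (@dual_monomial K n a).
Proof. by []. Qed.

HB.instance Definition _ a :=
  GRing.isLinear.Build K S K _ (@dual_monomial K n a) (dual_monomial_is_scalar a).

Lemma coefs_sum (I : Type) (r : seq I) (P : pred I) (F : I -> S) a :
  coefs (\sum_(i <- r | P i) F i) a = \sum_(i <- r | P i) coefs (F i) a.
Proof. exact: (raddf_sum (@dual_monomial K n a)). Qed.

Definition ordge k s := forall a, (mdeg a < k)%N -> coefs s a = 0.

Lemma ordge0 s : ordge 0 s. Proof. by []. Qed.

Lemma ordge_zero k : ordge k 0. Proof. by []. Qed.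

Lemma ordge_le k l s : (k <= l)%N -> ordge l s -> ordge k s.
Proof. by move=> kl sl a ak; apply/sl/(leq_trans ak). Qed.

Lemma ordgeD k s t : ordge k s -> ordge k t -> ordge k (s + t).
Proof. by move=> sk tk a ak /=; rewrite sk ?tk ?addr0. Qed.

Lemma ordgeN k s : ordge k s -> ordge k (- s).
Proof. by move=> sk a ak /=; rewrite sk ?oppr0. Qed.

Lemma ordgeB k s t : ordge k s -> ordge k t -> ordge k (s - t).
Proof. by move=> sk tk; apply: ordgeD => //; apply: ordgeN. Qed.

Lemma ordge_sum (I : Type) (r : seq I) (P : pred I) (F : I -> S) k :
  (forall i, P i -> ordge k (F i)) -> ordge k (\sum_(i <- r | P i) F i).
Proof.
by move=> Fk; elim/big_ind: _ => // s t; exact: ordgeD.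
Qed.

Lemma ordgeM k l s t : ordge k s -> ordge l t -> ordge (k + l) (s * t).
Proof.
move=> sk tl a akl; rewrite [LHS]/= big1 // => -[b c] /= /eqP abc.
have [/sk ->|kb] := ltnP (mdeg b) k; first by rewrite mul0r.
rewrite [coefs t _]tl ?mulr0 // -(ltn_add2l (mdeg b)) -mdegD -abc.
by rewrite (leq_trans akl) // leq_add2r.
Qed.

Lemma ordge_maxideal s : maxideal s <-> ordge 1 s.
Proof.
split=> [s0 a|]; last by apply; rewrite mdeg0.
by rewrite ltnS leqn0 mdeg_eq0 => /eqP ->.
Qed.

Lemma coefsXM i s a :
  coefs (mpsX K i * s) a =
  if (0 < a i)%N then coefs s (mnm_sub a (mnm1 i)) else 0.
Proof.
rewrite [LHS]/=; case: ifPn => [ai|]; last first.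
  rewrite -leqNgt leqn0 => /eqP ai; rewrite big1 // => -[b c] /= /eqP abc.
  case: eqP => [bi|]; last by rewrite mul0r.
  by have := congr1 (fun d : multinom n => d i) abc; rewrite /= mnmDE bi mnm1E eqxx ai.
have ia : a = mnm_add (mnm1 i) (mnm_sub a (mnm1 i)).
  by rewrite addmC submK //; apply/mnm_lepP => j; rewrite mnm1E; case: eqP => // <-.
have dX : (mdeg (mnm1 i : multinom n) < (mdeg a).+1)%N.
  by rewrite ltnS [in X in (_ <= X)%N]ia mdegD leq_addr.
have dY : (mdeg (mnm_sub a (mnm1 i)) < (mdeg a).+1)%N.
  by rewrite ltnS [in X in (_ <= X)%N]ia mdegD leq_addl.
rewrite (bigD1 (BMultinom dX, BMultinom dY)) /=; last by rewrite -ia.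
rewrite eqxx mul1r big1 ?addr0 // => -[b c] /= /andP[/eqP abc].
case: (bmnm b =P mnm1 i) => [bi|]; last by rewrite mul0r.
rewrite xpair_eqE !bmeqP /= bi eqxx /= => /negP[].
by rewrite [in mnm_sub a _]abc bi addmC addmK.
Qed.

(** Each monomial of positive degree is assigned by [lead] to one variable occurring in it; grouping
    the monomials of [s] accordingly and dividing by the variable gives the [t i]. *)
Lemma ordgeS_sum k s : ordge k.+1 s ->
  exists t : 'I_n -> S,
    (forall i, ordge k (t i)) /\ s = \sum_i mpsX K i * t i.
Proof.
move=> sk.
pose lead (i : 'I_n) a := [pick j | (0 < a j)%N] == Some i.
pose t i := MPSeries (fun a : multinom n =>
  if lead i (mnm_add a (mnm1 i)) then coefs s (mnm_add a (mnm1 i)) else 0).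
exists t; split=> [i a ak /=|].
  by case: ifP => // _; rewrite sk // mdegD mdeg1 addn1.
apply: mpseriesP => a; rewrite coefs_sum.
have tE i : coefs (mpsX K i * t i) a = if lead i a then coefs s a else 0.
  rewrite coefsXM; case: ifPn => [ai|ai0] /=.
    rewrite submK //; apply/mnm_lepP => j; rewrite mnm1E.
    by case: eqP => // <-.
  rewrite ifN // /lead; case: pickP => // j aj; apply/eqP => -[ji].
  by rewrite -ji aj in ai0.
under eq_bigr do rewrite tE; rewrite /lead.
case: pickP => [j aj|a0].
  rewrite (bigD1 j) //= eqxx big1 ?addr0 // => i ij.
  by rewrite ifN //; apply: contraNneq ij => -[->].
rewrite big1 // sk // (_ : a = mnm0) ?mdeg0 //.
apply/mnmP => i; rewrite mnm0E; have := a0 i; rewrite lt0n.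
by move/negbFE/eqP.
Qed.

(** A product of [k] series without constant term has order at least [k]; conversely [ordgeS_sum]
    splits off one variable at a time, each being one more factor in $\mathfrak m$. *)
Lemma ideal_exp_ordge k s : ideal_exp (@maxideal K n) k s <-> ordge k s.
Proof.
split=> [[r [c [x [xm ->]]]]|].
  apply: ordge_sum => i _; apply: (@ordgeM 0 k) => //.
  suff H m (y : 'I_m -> S) : (forall j, maxideal (y j)) ->
      ordge m (\prod_(j < m) y j) by apply: H => j; apply: xm.
  elim: m y => [|m IHm] y ym //; rewrite big_ord_recl.
  by apply: (@ordgeM 1 m); [apply/ordge_maxideal|apply: IHm].
have add k' s1 s2 : ideal_exp (@maxideal K n) k' s1 ->
    ideal_exp (@maxideal K n) k' s2 -> ideal_exp (@maxideal K n) k' (s1 + s2).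
  move=> [r1 [c1 [x1 [xm1 ->]]]] [r2 [c2 [x2 [xm2 ->]]]].
  exists (r1 + r2)%N.
  exists (fun i => match fintype.split i with inl i => c1 i | inr i => c2 i end).
  exists (fun i => match fintype.split i with inl i => x1 i | inr i => x2 i end).
  split=> [i j|]; first by case: fintype.split => l; [apply: xm1|apply: xm2].
  rewrite big_split_ord /=; congr (_ + _); apply: eq_bigr => i _.
    by have := unsplitK (inl i : 'I_r1 + 'I_r2) => /= ->.
  by have := unsplitK (inr i : 'I_r1 + 'I_r2) => /= ->.
have zero k' : ideal_exp (@maxideal K n) k' 0.
  exists 0%N, (fun=> 0), (fun _ _ => 0); split=> //.
  by rewrite big_ord0.
elim: k s => [|k IHk] s sk.
  exists 1%N, (fun=> s), (fun _ _ => 0); split=> //.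
  by rewrite big_ord1 big_ord0 mulr1.
have [t [tk ->]] := ordgeS_sum sk.
elim/big_ind: _ => [||i _]; [exact: zero|exact: add|].
have [r [c [x [xm ->]]]] := IHk _ (tk i).
exists r, c, (fun l j => oapp (x l) (mpsX K i) (unlift ord0 j)); split=> [l j|].
  case: unlift => [j'|] /=; first exact: xm.
  by apply/ordge_maxideal => a; rewrite ltnS leqn0 mdeg_eq0 => /eqP -> /=;
    rewrite eq_sym mnm1_eq0.
rewrite mulr_sumr; apply: eq_bigr => l _; rewrite big_ord_recl unlift_none /=.
under [in RHS]eq_bigr do rewrite liftK /=.
by rewrite mulrCA.
Qed.

Definition mono b : S := MPSeries (fun a => (a == b)%:R).

(** The difference of [s] and its truncation below degree [d] has order at least [d], so [F] kills
    it. *)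
Lemma linear_trunc (V : lmodType K) (F : {linear S -> V}) d s :
  (forall s, ordge d s -> F s = 0) ->
  F s = \sum_(b : bmultinom n d) coefs s b *: F (mono b).
Proof.
move=> F0; apply/eqP; rewrite -subr_eq0.
under eq_bigr do rewrite -linearZ; rewrite -linear_sum -linearB F0 //.
move=> a ad; rewrite [LHS]/= coefs_sum (bigD1 (BMultinom ad)) //= eqxx mulr1.
rewrite big1 ?addr0 ?subrr // => b; rewrite bmeqP /= eq_sym => /negPf ->.
by rewrite mulr0.
Qed.

End Order.

(** * Scalar powers of unipotent operators *)

Section UnipotentOperators.
Variables (K : numFieldType) (n : nat).
Local Notation S := (mpseries K n).
Implicit Types (s : S) (a b : multinom n) (k m : nat) (t : K).
Implicit Types (T U : {linear S -> S}).

Definition unipotent (T : S -> S) :=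
  forall k s, ordge k s -> ordge k.+1 (T s - s).

Definition preserves_order (F : S -> S) := forall k s, ordge k s -> ordge k (F s).

Lemma unipotent_preserves_order (F : S -> S) : unipotent F -> preserves_order F.
Proof.
move=> uF k s sk; rewrite -[F s](subrK s); apply: ordgeD => //.
exact/(ordge_le (leqnSn k))/uF.
Qed.

(** If $s$ has order at least $j<k$, then $s=F(s)-(F(s)-s)$ has order at least $j+1$. *)
Lemma unipotent_ordge_inv (F : S -> S) k s : unipotent F -> ordge k (F s) -> ordge k s.
Proof.
move=> uF Fs; suff H j : (j <= k)%N -> ordge j s by exact: H.
elim: j => [|j IHj] jk; first exact: ordge0.
rewrite -[s](subKr (F s)); apply: ordgeB; first exact: ordge_le Fs.
exact/uF/IHj/ltnW.
Qed.

Lemma unipotent_comp (F G : S -> S) :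
  unipotent F -> unipotent G -> unipotent (F \o G).
Proof.
move=> uF uG k s sk; rewrite -(subrKA (G s)); apply: ordgeD; last exact: uG.
exact/uF/(unipotent_preserves_order uG).
Qed.

Lemma unipotent_inv (F G : S -> S) : unipotent F -> cancel G F -> unipotent G.
Proof.
move=> uF FG k s sk; rewrite -opprB -[s in s - _]FG; apply/ordgeN/uF.
by apply: (unipotent_ordge_inv uF); rewrite FG.
Qed.

Definition iterl T k : S -> S := iter k T.

Lemma iterl_is_linear T k : linear (iterl T k).
Proof. by elim: k => [|k IHk] c s1 s2 //=; rewrite [LHS]/= -linearP -IHk. Qed.

HB.instance Definition _ T k :=
  GRing.isLinear.Build K S S _ (iterl T k) (iterl_is_linear T k).

Definition delta T k : S -> S := iterl (T \- idfun) k.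

HB.instance Definition _ T k := GRing.Linear.on (delta T k).

Lemma deltaS T k s : delta T k.+1 s = delta T k (T s) - delta T k s.
Proof. by rewrite -linearB /delta /iterl iterSr. Qed.

Lemma ordge_delta T : unipotent T ->
  forall k l s, ordge l s -> ordge (k + l) (delta T k s).
Proof. by move=> uT; elim=> // k IHk l s sl; apply/uT/IHk. Qed.

Lemma coefs_delta0 T k s a :
  unipotent T -> (mdeg a < k)%N -> coefs (delta T k s) a = 0.
Proof.
by move=> uT ak; apply: (ordge_delta uT (@ordge0 _ _ s)); rewrite addn0.
Qed.

(* The sum is finite since [(T - 1)^k s] has order at least [k]. *)
Definition opow T t : S -> S := fun s => MPSeries (fun a =>
  \sum_(k < (mdeg a).+1) gbin k t * coefs (delta T k s) a).

Lemma opow_is_linear T t : linear (opow T t).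
Proof.
move=> c s1 s2; apply: mpseriesP => a /=; rewrite mulr_sumr -big_split /=.
by apply: eq_bigr => k _; rewrite linearP /=; ring.
Qed.

HB.instance Definition _ T t :=
  GRing.isLinear.Build K S S _ (opow T t) (opow_is_linear T t).

Lemma coefs_opow T t s a m : unipotent T -> (mdeg a < m)%N ->
  coefs (opow T t s) a = \sum_(k < m) gbin k t * coefs (delta T k s) a.
Proof.
move=> uT am /=.
rewrite (big_ord_widen m (fun k => gbin k t * coefs (delta T k s) a)) //.
rewrite big_mkcond; apply: eq_bigr => k _; case: ifPn => //.
by rewrite -leqNgt => ak; rewrite coefs_delta0 ?mulr0.
Qed.

Lemma unipotent_opow T t : unipotent T -> unipotent (opow T t).
Proof.
move=> uT k s sk a ak.
rewrite [LHS]/= (big_ord_recl (mdeg a)) gbin0 mul1r [coefs (delta T 0 s) a]/=.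
rewrite addrC addKr big1 // => j _; rewrite lift0.
rewrite (ordge_delta uT sk) ?mulr0 //.
by rewrite addSn (leq_trans ak) // ltnS leq_addl.
Qed.

Lemma opow0 T s : opow T 0 s = s.
Proof.
apply: mpseriesP => a /=; rewrite big_ord_recl gbin0 mul1r.
by rewrite big1 ?addr0 // => k _; rewrite lift0 gbinS_0 mul0r.
Qed.

(** Expanding $T=1+(T-1)$ on the right gives two series, which Pascal's rule merges; the extra top
    term vanishes because of its order. *)
Lemma opow_succ T t s : unipotent T -> opow T (t + 1) s = opow T t (T s).
Proof.
move=> uT; apply: mpseriesP => a; pose d k := coefs (delta T k s) a.
rewrite /= big_ord_recl gbin0 mul1r.
have -> : \sum_(k < (mdeg a).+1) gbin k t * coefs (delta T k (T s)) a =
    \sum_(k < (mdeg a).+1) gbin k t * d k +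
    \sum_(k < (mdeg a).+1) gbin k t * d k.+1.
  rewrite -big_split; apply: eq_bigr => k _ /=.
  by rewrite /d -mulrDr deltaS /=; congr (_ * _); ring.
rewrite big_ord_recl [X in _ = _ + X]big_ord_recr /= gbin0 mul1r /d.
rewrite [coefs (delta T (mdeg a).+1 s) a]coefs_delta0 // mulr0 addr0 -addrA.
rewrite -big_split; congr (_ + _); apply: eq_bigr => k _.
by rewrite [bump _ _]add1n gbin_pascal mulrDl.
Qed.

Lemma opow_nat T m s : unipotent T -> opow T m%:R s = iter m T s.
Proof.
move=> uT; elim: m s => [|m IHm] s; first exact: opow0.
by rewrite -natr1 opow_succ // IHm iterSr.
Qed.

Lemma poly_fun_coefs_opow T c s a : poly_fun (fun t => coefs (opow T (c + t) s) a).
Proof.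
apply: poly_fun_sum => k _; apply: poly_funM; last exact: poly_fun_cst.
exact: poly_fun_gbin.
Qed.

(** Only finitely many coefficients of [s] matter, so applying [T] preserves polynomial dependence
    on a parameter. *)
Lemma coefs_linear T s a m : preserves_order T -> (mdeg a < m)%N ->
  coefs (T s) a = \sum_(b : bmultinom n m) coefs s b * coefs (T (mono K b)) a.
Proof.
move=> pT am.
have := @linear_trunc K n K^o (@dual_monomial K n a \o T) m s.
by apply=> r rm; apply: (pT m).
Qed.

(** Two interpolations: first in the inner exponent while the outer one is a natural number, then in
    the outer exponent. *)
Lemma opow_add T t t' s : unipotent T -> opow T t (opow T t' s) = opow T (t + t') s.
Proof.
move=> uT.
have opow_add_nat m t0 : opow T m%:R (opow T t0 s) = opow T (m%:R + t0) s.
  apply: mpseriesP => a; move: t0; apply: poly_fun_ext => [||l].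
  - have pT : preserves_order (opow T m%:R).
      exact/unipotent_preserves_order/unipotent_opow.
    under eq_fun do rewrite (coefs_linear _ pT (ltnSn _)).
    apply: poly_fun_sum => b _; apply: poly_funM; last exact: poly_fun_cst.
    by under eq_fun do rewrite -[X in opow T X]add0r; exact: poly_fun_coefs_opow.
  - exact: poly_fun_coefs_opow.
  - by rewrite -natrD !opow_nat // iterD.
apply: mpseriesP => a; move: t; apply: poly_fun_ext => [||l].
- by under eq_fun do rewrite -[X in opow T X]add0r; exact: poly_fun_coefs_opow.
- by under eq_fun do rewrite addrC; exact: poly_fun_coefs_opow.
- by rewrite opow_add_nat.
Qed.

Lemma opowK T t : unipotent T -> cancel (opow T t) (opow T (- t)).
Proof. by move=> uT s; rewrite opow_add // addNr opow0. Qed.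

Lemma opowNK T t : unipotent T -> cancel (opow T (- t)) (opow T t).
Proof. by move=> uT s; rewrite opow_add // subrr opow0. Qed.

Lemma opow1 T s : unipotent T -> opow T 1 s = T s.
Proof. by move=> uT; rewrite (opow_nat 1). Qed.

(** Three copies of an automorphism $\psi$ make $\psi^t$ multiplicative; the triple $T,T,\psi$
    yields $T^t(s)=T^t(1)\psi^t(s)$. *)
Lemma opow_mul T1 T2 T3 : unipotent T1 -> unipotent T2 -> unipotent T3 ->
  (forall s1 s2, T1 (s1 * s2) = T2 s1 * T3 s2) ->
  forall t s1 s2, opow T1 t (s1 * s2) = opow T2 t s1 * opow T3 t s2.
Proof.
move=> u1 u2 u3 TM t s1 s2; apply: mpseriesP => a; move: t.
apply: poly_fun_ext => [||m].
- by under eq_fun do rewrite -[X in opow T1 X]add0r; exact: poly_fun_coefs_opow.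
- apply: poly_fun_sum => k _; apply: poly_funM;
  by under eq_fun do rewrite -[X in opow _ X]add0r; exact: poly_fun_coefs_opow.
- rewrite !opow_nat //; congr (coefs _ a).
  by elim: m => //= m ->; rewrite TM.
Qed.

End UnipotentOperators.

(** * The structure of $\mathbb G^+$ and its stability under scalar powers *)

Section Group.
Variables (K : numFieldType) (n : nat).
Local Notation S := (mpseries K n).
Implicit Types (s : S) (phi : S -> S).

Lemma ordge_mpsX i : ordge 1 (mpsX K i : S).
Proof.
by apply/ordge_maxideal; rewrite /maxideal /= eq_sym mnm1_eq0.
Qed.

(** Induction on the order: a series is a finite sum of multiples of the variables, which passes
    through $\psi$ by additivity alone. *)
Lemma Autp_unipotent (psi : {lrmorphism S -> S}) : is_Autp psi -> unipotent psi.
Proof.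
move=> [_ psiX].
have psiX2 i : ordge 2 (psi (mpsX K i) - mpsX K i) by exact/ideal_exp_ordge.
have psiX1 i : ordge 1 (psi (mpsX K i)).
  rewrite -[psi _](subrK (mpsX K i)); apply: ordgeD; last exact: ordge_mpsX.
  exact: ordge_le (psiX2 i).
elim=> [|k IHk] s sk.
  (* The constant term is fixed by $\psi$ and cancels; the rest lies in $\mathfrak m$ both before
     and after applying $\psi$. *)
  have : ordge 1 (s - coefs s mnm0 *: 1).
    by apply/ordge_maxideal; rewrite /maxideal /= eqxx mulr1 subrr.
  move=> /ordgeS_sum[t [_ st]].
  rewrite -[s](subrK (coefs s mnm0 *: 1)) st linearD linearZ rmorph1 /=.
  rewrite opprD addrACA subrr addr0 rmorph_sum.
  apply: ordgeB; apply: ordge_sum => i _.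
    rewrite rmorphM; apply: (@ordgeM _ _ 1 0); [exact: psiX1|exact: ordge0].
  by apply: (@ordgeM _ _ 1 0) => //; exact: ordge_mpsX.
have [t [tk ->]] := ordgeS_sum sk.
rewrite rmorph_sum -sumrB; apply: ordge_sum => i _.
(* In this twisted Leibniz rule the first summand gains order from the variable, the second from the
   induction hypothesis. *)
have -> : psi (mpsX K i * t i) - mpsX K i * t i =
    (psi (mpsX K i) - mpsX K i) * psi (t i) + mpsX K i * (psi (t i) - t i).
  by rewrite rmorphM mulrBl mulrBr addrA subrK.
apply: ordgeD.
  apply: (@ordgeM _ _ 2 k) => //; rewrite -[psi _](subrK (t i)).
  by apply: ordgeD => //; apply/(ordge_le (leqnSn k))/IHk.
by apply: (@ordgeM _ _ 1 k.+1); [exact: ordge_mpsX|exact: IHk].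
Qed.

Lemma unipotent_Autp (psi : {lrmorphism S -> S}) :
  unipotent psi -> bijective psi -> is_Autp psi.
Proof.
by move=> upsi bij; split=> // i; apply/ideal_exp_ordge/upsi/ordge_mpsX.
Qed.

Lemma lrmorphism_of (F : S -> S) : linear F -> GRing.monoid_morphism F ->
  exists psi : {lrmorphism S -> S}, F = psi :> (S -> S).
Proof.
move=> linF monF.
pose psi : {lrmorphism S -> S} := HB.pack F (GRing.isLinear.Build K S S _ F linF)
  (GRing.isMonoidMorphism.Build S S F monF).
by exists psi.
Qed.

(** Twisted multiplicativity survives all four constructors of [Gp]: the twist is $\psi$ itself for
    an automorphism, the identity for a multiplication, and it is composed and inverted along with
    the operator. *)
Lemma Gp_semilinear phi : Gp phi ->
  exists (T : {linear S -> S}) (psi : {lrmorphism S -> S}),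
  [/\ phi = T :> (S -> S), unipotent T, is_Autp psi
    & forall s t, T (s * t) = T s * psi t].
Proof.
have linearW (F : S -> S) : linear F -> exists T : {linear S -> S}, F = T :> (S -> S).
  move=> linF.
  by exists (HB.pack_for {linear S -> S} F (GRing.isLinear.Build K S S _ F linF)).
elim=> {phi} [psi psiA|u u1|_ _ _ [T [psi [-> uT psiA TM]]] _ [U [chi [-> uU chiA UM]]]
             |_ G _ [T [psi [-> uT psiA TM]]] TG GT].
- exists psi, psi; split=> //; first exact: Autp_unipotent.
  exact: rmorphM.
- have [T TE] : exists T : {linear S -> S}, (fun s => u * s) = T :> (S -> S).
    by apply: linearW => c s t; rewrite mulrDr scalerAr.
  exists T, idfun; split=> //; rewrite -?TE.
  + move=> k s sk; rewrite -[X in _ - X]mul1r -mulrBl -add1n.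
    by apply: ordgeM => //; apply/ordge_maxideal.
  + apply: unipotent_Autp; last by exists idfun.
    by move=> k s _; rewrite subrr; exact: ordge_zero.
  + by move=> s t; rewrite mulrA.
- have uTU := unipotent_comp uT uU.
  exists (T \o U), (psi \o chi); split=> //.
    apply: unipotent_Autp.
      by apply: unipotent_comp; apply: Autp_unipotent.
    by apply: bij_comp; [case: psiA|case: chiA].
  by move=> s t /=; rewrite UM TM.
- have [psi' psiK psi'K] := proj1 psiA.
  have [psiV psiVE] : exists psiV : {lrmorphism S -> S}, psi' = psiV :> (S -> S).
    apply: lrmorphism_of; first exact: (can2_linear psiK psi'K).
    exact: (can2_monoid_morphism psiK psi'K).
  rewrite {}psiVE in psiK psi'K.
  have [U UE] := linearW G (can2_linear TG GT).
  rewrite {}UE {G} in TG GT *.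
  exists U, psiV; split=> //.
  + exact: unipotent_inv uT GT.
  + apply: unipotent_Autp; last by exists psi.
    exact: unipotent_inv (Autp_unipotent psiA) psi'K.
  + by move=> s t; apply: (can_inj TG); rewrite GT TM GT psi'K.
Qed.

Lemma Gp_opow (T : {linear S -> S}) t : Gp T -> Gp (opow T t).
Proof.
move=> /Gp_semilinear[T' [psi [TT' uT psiA TM]]].
rewrite -{}TT' {T'} in uT TM.
have upsi := Autp_unipotent psiA.
have opsiM := opow_mul upsi upsi upsi (rmorphM psi).
have [chi chiE] : exists chi : {lrmorphism S -> S}, opow psi t = chi :> (S -> S).
  apply: lrmorphism_of; first exact: opow_is_linear.
  split; last exact: opsiM.
  (* Iterates of $\psi$ fix 1; by interpolation so does $\psi^t$. *)
  have o1 m : opow psi m%:R (1 : S) = 1.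
    by rewrite opow_nat //; elim: m => //= m ->; rewrite rmorph1.
  apply: mpseriesP => a; move: t; apply: poly_fun_ext => [||m].
  - by under eq_fun do rewrite -[X in opow psi X]add0r; exact: poly_fun_coefs_opow.
  - exact: poly_fun_cst.
  - by rewrite o1.
(* This is [opow_mul] with first factor 1; the multiplier $T^t(1)$ lies in $1+\mathfrak m$ because
   $T^t$ is unipotent. *)
have -> : opow T t = (fun s => opow T t 1 * s) \o chi.
  apply/funext => s /=.
  by rewrite -chiE -(opow_mul uT uT upsi TM) mul1r.
apply: Gp_comp.
  apply: Gp_mul; apply/ordge_maxideal.
  exact: (unipotent_opow t uT (@ordge0 _ _ 1)).
apply: Gp_aut; apply: unipotent_Autp; rewrite -chiE.
  exact: unipotent_opow.
by exists (opow psi (- t)); [exact: opowK|exact: opowNK].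
Qed.

End Group.

(** * The action of $\mathbb G^+$ on $P_{\le D}$ by matrices *)

Section OrbitClosed.
Variables (K : numFieldType) (n D : nat).
Local Notation S := (mpseries K n).
Local Notation N := (dimP n D).
Implicit Types (s : S) (T U : {linear S -> S}).

Definition expo (i : 'I_N) : multinom n := bmnm (enum_val i).

Lemma expo_inj : injective expo.
Proof. by move=> i j ij; apply/enum_val_inj/val_inj. Qed.

Lemma mdeg_expo i : (mdeg (expo i) < D.+1)%N.
Proof. exact: bmdeg. Qed.

(** Input monomials index the columns, so the dual action on row vectors of coordinates is
    multiplication on the right. *)
Definition opmx (F : S -> S) : 'M[K]_N :=
  \matrix_(i, j) coefs (F (mono K (expo j))) (expo i).

Lemma coefs_expo T s i : preserves_order T ->
  coefs (T s) (expo i) = \sum_j opmx T i j * coefs s (expo j).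
Proof.
move=> pT; rewrite (coefs_linear s pT (mdeg_expo i)).
rewrite (eq_bigl (mem {: bmultinom n D.+1})) // big_enum_val.
by apply: eq_bigr => j _; rewrite mxE mulrC.
Qed.

Lemma of_coords_op T v s : preserves_order T ->
  of_coords v (T s) = of_coords (v *m opmx T) s.
Proof.
move=> pT; rewrite /of_coords /dual_monomial.
under eq_bigr do rewrite (coefs_expo s _ pT) mulr_sumr.
rewrite exchange_big; apply: eq_bigr => j _; rewrite mxE mulr_suml.
by apply: eq_bigr => i _; rewrite mulrA.
Qed.

Lemma of_coords_inj : injective (@of_coords K n D).
Proof.
move=> v w vw; apply/rowP => j.
have ev (u : 'rV[K]_N) : of_coords u (mono K (expo j)) = u 0 j.
  rewrite /of_coords (bigD1 j) //= eqxx mulr1 big1 ?addr0 // => i ij.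
  by rewrite (inj_eq expo_inj) (negPf ij) mulr0.
by rewrite -!ev vw.
Qed.

Lemma opmx_id : opmx id = 1.
Proof. by apply/matrixP => i j; rewrite !mxE /= (inj_eq expo_inj). Qed.

Lemma opmx_comp T (F : S -> S) : preserves_order T ->
  opmx (T \o F) = opmx T *m opmx F.
Proof.
move=> pT; apply/matrixP => i j; rewrite !mxE /= coefs_expo //.
by apply: eq_bigr => k _; rewrite [opmx F _ _]mxE.
Qed.

Lemma opmx_delta T k : unipotent T -> opmx (delta T k) = (opmx T - 1) ^+ k.
Proof.
move=> uT; have subE : opmx (T \- idfun) = opmx T - 1.
  by rewrite -opmx_id; apply/matrixP => i j; rewrite !mxE.
elim: k => [|k IHk]; first by rewrite expr0 -opmx_id.
rewrite exprS -IHk -subE -[RHS]/(_ *m _) -opmx_comp // => l s sl.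
exact/(ordge_le (leqnSn l))/uT.
Qed.

(** All exponents have degree at most $D$, so their series can be cut uniformly at the $D+2$ terms
    of [mxpow]. *)
Lemma opmx_opow T t : unipotent T -> opmx (opow T t) = mxpow D (opmx T) t.
Proof.
move=> uT; apply/matrixP => i j.
rewrite mxE (coefs_opow _ _ uT (leqW (mdeg_expo i))) summxE.
by apply: eq_bigr => k _; rewrite [in RHS]mxE -opmx_delta // mxE.
Qed.

Lemma Gp_unipotent_group :
  unipotent_group (fun i => mdeg (expo i)) D [set opmx phi | phi in @Gp K n].
Proof.
split.
- move=> _ [phi Gphi <-] i j ij.
  have [T [_ [-> uT _ _]]] := Gp_semilinear Gphi.
  have mono_ord : ordge (mdeg (expo j)) (mono K (expo j)).
    by move=> a; rewrite /=; case: eqP => // ->; rewrite ltnn.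
  have := uT _ _ mono_ord (expo i); rewrite ltnS => /(_ ij).
  by rewrite -opmx_id !mxE.
- exists (fun s => 1 * s); first by apply: Gp_mul; rewrite subrr.
  by rewrite -opmx_id; congr opmx; apply/funext => s; rewrite mul1r.
- move=> _ _ [phi Gphi <-] [chi Gchi <-]; exists (phi \o chi).
    exact: Gp_comp.
  have [T [_ [-> uT _ _]]] := Gp_semilinear Gphi.
  exact/opmx_comp/unipotent_preserves_order.
- move=> _ [phi Gphi <-].
  have [T [_ [phiT uT _ _]]] := Gp_semilinear Gphi; rewrite {}phiT in Gphi *.
  (* The scalar power with exponent $-1$ is the inverse, already known to lie in [Gp]. *)
  exists (opmx (opow T (- 1))).
    by exists (opow T (- 1)) => //; exact: Gp_opow.
  rewrite -opmx_comp; last exact: unipotent_preserves_order.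
  rewrite -opmx_id; congr opmx; apply/funext => s /=.
  by rewrite -opow1 // opow_add // subrr opow0.
- move=> _ t [phi Gphi <-].
  have [T [_ [phiT uT _ _]]] := Gp_semilinear Gphi; rewrite {}phiT in Gphi *.
  by exists (opow T t); [exact: Gp_opow|rewrite opmx_opow].
Qed.

Lemma Gp_orbit_of_coords v :
  Gp_orbit (of_coords v) =
  @of_coords K n D @` [set v *m g | g in [set opmx phi | phi in @Gp K n]].
Proof.
have dualE phi : Gp phi -> dual_map phi (of_coords v) = of_coords (v *m opmx phi).
  move=> /Gp_semilinear[T [_ [-> uT _ _]]]; apply/funext => s.
  exact/of_coords_op/unipotent_preserves_order.
apply/seteqP; split=> f /= => [[phi Gphi <-]|[_ [_ [phi Gphi <-] <-] <-]].
  exists (v *m opmx phi); last by rewrite dualE.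
  by exists (opmx phi) => //; exists phi.
by exists phi => //; rewrite dualE.
Qed.

End OrbitClosed.

(** * Closedness of the orbits in $P$ *)

Lemma Pspace_Ple (K : numFieldType) n (f : mpseries K n -> K) : Pspace f ->
  \forall D \near \oo, Ple D f.
Proof.
move=> [flin [k fk]].
pose F : {scalar mpseries K n} := HB.pack_for {scalar mpseries K n} f
  (GRing.isLinear.Build K (mpseries K n) K _ f flin).
(* The coordinates of [f] are its values on monomials; $D\ge k$ makes [f] vanish on series of order
   at least $D+1$. *)
near=> D; exists (\row_i f (mono K (expo i))) => //; apply/funext => s.
rewrite [RHS](@linear_trunc _ _ _ F D.+1 s); last first.
  move=> t tD; apply: fk; apply/ideal_exp_ordge/(ordge_le _ tD)/leqW.
  by near: D; exact: nbhs_infty_ge.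
rewrite (eq_bigl (mem {: bmultinom n D.+1})) // big_enum_val.
by apply: eq_bigr => i _; rewrite mxE mulrC.
Unshelve. all: by end_near. Qed.

(** Abstracting the notion of closedness serves both topologies at once. *)
Lemma Gp_orbit_closed (K : numFieldType) n (f : mpseries K n -> K)
    (is_closed : forall N, set 'rV[K]_N -> Prop) :
  (forall N A, @zariski_closed K N A -> is_closed N A) ->
  Pspace f -> closed_in_P is_closed (Gp_orbit f).
Proof.
move=> zc /Pspace_Ple fP; rewrite /closed_in_P; near=> D.
have [v _ <-] : Ple D f by near: D.
rewrite Gp_orbit_of_coords; split; first by move=> _ [w _ <-]; exists w.
have -> : forall B, @of_coords K n D @^-1` (@of_coords K n D @` B) = B.
  move=> B; apply/seteqP; split=> w /= => [[w' Bw' /of_coords_inj <-]|Bw] //.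
  by exists w.
exact/zc/(unipotent_orbit_closed v (Gp_unipotent_group K n D)).
Unshelve. all: by end_near. Qed.

Theorem theorem2p21 (R : realType) (n : nat)
    (f : mpseries R[i] n -> R[i]) (hf : Pspace f) :
  closed_in_P (@euclidean_closed R[i]) (Gp_orbit f) /\
  closed_in_P (@zariski_closed R[i]) (Gp_orbit f).
Proof.
by split; apply: Gp_orbit_closed => // N A; exact: zariski_closed_euclidean.
Qed.
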